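(* Let $X$ be a locally compact zero-dimensional space, let $G$ be an equicontinuously generated group of homeomorphisms of $X$, let $V$ be an open subset of $X$ and write $V_{\infty} = \bigcap_{g \in G} g(V)$. Suppose that $V_{\infty}$ is compact. Then $V_{\infty}$ is open if and only if $\overline{Gx} \cap V_{\infty} = \emptyset$ for every $x \in X \smallsetminus V_{\infty}$.
   Context: A locally compact space is zero-dimensional if it is Hausdorff and has a base consisting of clopen sets. $Gx = \{gx \mid g \in G\}$ and the bar denotes closure in $X$. A set $S$ of homeomorphisms of $X$ is equicontinuous at $x \in X$ with respect to a uniformity $\mathcal{U}$ on $X$ compatible with the topology if for every entourage $E \in \mathcal{U}$ there is a neighbourhood $N$ of $x$ such that $(sx,sy) \in E$ for all $s \in S$ and $y \in N$; $S$ is equicontinuous if it is equicontinuous at every point of $X$. A group $G$ of homeomorphisms of $X$ is equicontinuously generated if it has a symmetric generating set $S$ (i.e. $S = S^{-1}$) that is equicontinuous with respect to some compatible uniformity on $X$. *)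

(* Defs.v *)
From mathcomp Require Import all_boot all_classical topology.

Set Implicit Arguments.
Unset Strict Implicit.
Unset Printing Implicit Defensive.

Local Open Scope classical_set_scope.

(* The library's [zero_dimensional] asks only that distinct points be separated
   by a clopen set, which in general is weaker than having a clopen base. *)
Definition zero_dim_space (X : topologicalType) : Prop :=
  hausdorff_space X /\ exists2 B : set_system X, basis B & B `<=` clopen.

(* The axioms of the library's [uniformType] for a uniformity on the carrier of
   a fixed topological space; the last one says that the uniform topology is the
   given topology. *)
Record compatible_uniformity (X : topologicalType) (U : set_system (X * X)) :
    Prop := CompatibleUniformity {
  cunif_filter : Filter U;
  cunif_diagonal : forall E, U E -> (diagonal `<=` E)%relation;
  cunif_inv : forall E, U E -> U (E^-1)%relation;
  cunif_split : forall E, U E -> exists2 D, U D & (D \; D `<=` E)%relation;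
  cunif_nbhs : nbhs = nbhs_ U }.

(* Pointwise the library's [equicontinuous], which is available only for maps
   into a pointed (hence nonempty) uniform space. *)
Definition equicontinuous_for (X : topologicalType) (U : set_system (X * X))
    (S : set (X -> X)) : Prop :=
  forall (x : X) (E : set (X * X)), U E ->
    \forall y \near x, forall s, S s -> E (s x, s y).

Definition inverse_maps (X : Type) (S : set (X -> X)) : set (X -> X) :=
  [set g | exists2 f, S f & cancel f g /\ cancel g f].

Definition homeomorphism (X : topologicalType) (f : X -> X) : Prop :=
  continuous f /\ exists2 g, continuous g & cancel f g /\ cancel g f.

Record homeo_group (X : topologicalType) (G : set (X -> X)) : Prop :=
  HomeoGroup {
    homeo_group_homeo : G `<=` @homeomorphism X;
    homeo_group_id : G id;
    homeo_group_comp : forall f g, G f -> G g -> G (f \o g);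
    homeo_group_inv : inverse_maps G `<=` G }.

(* If [G] is a group of homeomorphisms, the equation forces [S `<=` G]:
   [smallest] is an intersection of sets that all contain [S]. *)
Definition generates (X : topologicalType) (S G : set (X -> X)) : Prop :=
  G = smallest (@homeo_group X) S.

Definition equicontinuously_generated (X : topologicalType)
    (G : set (X -> X)) : Prop :=
  exists S : set (X -> X),
    [/\ generates S G, S = inverse_maps S &
        exists2 U, compatible_uniformity U & equicontinuous_for U S].

Definition group_orbit (X : Type) (G : set (X -> X)) (x : X) : set X :=
  [set g x | g in G].

Definition invariant_core (X : Type) (G : set (X -> X)) (V : set X) : set X :=
  \bigcap_(g in G) (g @` V).

(* Main.v *)
Require Import Defs.
From mathcomp Require Import all_boot all_classical topology.

Set Implicit Arguments.
Unset Strict Implicit.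
Unset Printing Implicit Defensive.

Local Open Scope classical_set_scope.

(** The core K of V is also the core of a compact clopen set W with
    K `<=` W `<=` V. Let W_n be the set of points that no product of at most n
    elements of S moves out of W. Equicontinuity makes every W_n clopen, and
    K is the intersection of the W_n. If K is not open, no W_n equals W_(n+1),
    so for each n some point of W \ W_1 is carried into W_n by n steps of S
    inside W. These points form a decreasing sequence of nonempty compact sets;
    a point common to all of them lies outside K, and its orbit meets every
    W_n, so by compactness its orbit closure meets K. *)

(** * Invariance of the core under the group *)

Section InvariantCore.
Variables (X : topologicalType) (G : set (X -> X)).
Hypothesis grpG : homeo_group G.

Lemma invariant_core_sub (V : set X) : invariant_core G V `<=` V.
Proof. by move=> x /(_ _ (homeo_group_id grpG)) [y Vy <-]. Qed.

Lemma invariant_core_stable (V : set X) (h : X -> X) (x : X) :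
  G h -> invariant_core G V x -> invariant_core G V (h x).
Proof.
move=> Gh Kx g Gg.
have [_ [h' _ [hK h'K]]] := homeo_group_homeo grpG Gh.
have Gh' : G h' by apply: (homeo_group_inv grpG); exists h.
have [v Vv vE] := Kx _ (homeo_group_comp grpG Gh' Gg).
by exists v => //; rewrite -vE /= h'K.
Qed.

Lemma stable_sub_invariant_core (S : set (X -> X)) (V P : set X) :
  generates S G -> S = inverse_maps S -> P `<=` V ->
  (forall s x, S s -> P x -> P (s x)) -> P `<=` invariant_core G V.
Proof.
move=> genG symS PV Pstable.
have SG : S `<=` G by rewrite genG; exact: sub_gen_smallest.
pose H := [set h | homeomorphism h /\ forall x, P (h x) <-> P x].
have SH : S `<=` H.
  move=> s Ss; split; first exact/(homeo_group_homeo grpG)/SG.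
  move=> x; split; last exact: Pstable.
  have [f Sf [_ sK]] : inverse_maps S s by rewrite -symS.
  have [f' Sf' [f'K fK']] : inverse_maps S f by rewrite -symS.
  by move=> /(Pstable _ _ Sf); rewrite -[f _]f'K fK' -{1}[x]fK' sK fK'.
have groupH : homeo_group H.
  split.
  - by move=> h [].
  - split; last by [].
    by split; [move=> x; exact: cvg_id|exists id; [move=> x; exact: cvg_id|]].
  - move=> f g [[fc [f' f'c [fK f'K]]] fP] [[gc [g' g'c [gK g'K]]] gP].
    split; last by move=> x; rewrite /= fP gP.
    split; first by move=> x; apply: continuous_comp; [exact: gc|exact: fc].
    exists (g' \o f').
      by move=> x; apply: continuous_comp; [exact: f'c|exact: g'c].
    by split=> x /=; rewrite ?fK ?gK ?g'K ?f'K.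
  - move=> g [f [[fc [f' f'c [fK f'K]]] fP] [fgK gfK]].
    have gE : g = f' by apply/funext => x; rewrite -{1}[x]f'K fgK.
    split; last by move=> x; rewrite -fP gfK.
    by rewrite gE; split=> //; exists f.
have GH : G `<=` H by rewrite genG; exact: smallest_sub.
move=> x Px g Gg.
have [_ [g' _ [gK g'K]]] := homeo_group_homeo grpG Gg.
have [_ g'P] : H g' by apply/GH/(homeo_group_inv grpG); exists g.
by exists (g' x); rewrite ?g'K//; apply/PV/g'P.
Qed.

End InvariantCore.

(** * Compactness and clopen sets *)

Lemma locally_constant_clopen (X : topologicalType) (P : set X) :
  (forall x, \forall y \near x, P x <-> P y) -> clopen P.
Proof.
move=> Pcst; split.
  by rewrite openE => x Px; apply: filterS (Pcst x) => y /iffLR; apply.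
by move=> x /(_ _ (Pcst x)) [y [Py /iffRL]]; apply.
Qed.

Lemma compact_nested_nonempty (X : topologicalType) (W : set X)
    (A : nat -> set X) :
  compact W -> (forall n, closed (A n)) -> (forall n, A n `<=` W) ->
  (forall n, A n.+1 `<=` A n) -> (forall n, A n !=set0) ->
  \bigcap_n A n !=set0.
Proof.
move=> cW cA AW Adec A0.
have Ale m n : (m <= n)%N -> A n `<=` A m.
  by move=> /subnK <-; elim: (n - m)%N => // k IH x /Adec /IH.
pose F := filter_from setT A.
have FF : ProperFilter F.
  apply: filter_from_proper => //; apply: filter_fromT_filter; first by exists 0.
  move=> i j; exists (maxn i j) => x Ax.
  by split; apply: Ale Ax; rewrite ?leq_maxl ?leq_maxr.
have FA n : F (A n) by exists n.
have [|p [_ clp]] := cW F FF; first exact: filterS (AW 0) (FA 0).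
by exists p => n _; apply: cA => B /(clp _ _ (FA n)).
Qed.

(** Finite subcovers in the form used below: a property of sets that passes to unions and holds near
    each point of [K] holds for some set containing [K]. *)
Lemma compact_cover_directed (X : topologicalType) (K : set X)
    (Q : set (set X)) :
  compact K -> Q set0 -> setU_closed Q ->
  (forall x, K x -> exists2 C, Q C & nbhs x C) ->
  exists2 C, Q C & K `<=` C.
Proof.
move=> /compact_near_coveringP cK Q0 QU Kx.
(* [F] is the filter of eventually large members of [Q]; closure under unions makes it a filter. *)
pose F := filter_from Q (fun C => [set D | Q D /\ C `<=` D]).
have FF : Filter F.
  apply: filter_from_filter; first by exists set0.
  move=> C D QC QD; exists (C `|` D); first exact: QU.
  by move=> E [QE]; rewrite subUset => -[CE DE]; split.
have [|C QC KC] := cK _ F (fun C x => C x) FF; last first.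
  by exists C => //; exact: (KC C (conj QC (fun _ => id))).
move=> x /Kx [C QC xC]; exists (C, [set D | Q D /\ C `<=` D]) => /=.
  by split=> //; exists C.
by move=> [y D] /= [Cy [_]]; apply.
Qed.

Lemma compact_clopen_between (X : topologicalType) (K V : set X) :
  locally_compact [set: X] -> zero_dim_space X ->
  compact K -> open V -> K `<=` V ->
  exists W, [/\ compact W, clopen W, K `<=` W & W `<=` V].
Proof.
move=> lcX [hX [B [_ Bb] Bclopen]] cK oV KV.
pose Q := [set C : set X | [/\ compact C, clopen C & C `<=` V]].
have [| | |W [cW clW WV] KW] := @compact_cover_directed X K Q cK.
- by split=> //; [exact: compact0 | split; [exact: open0|exact: closed0]].
- move=> C D [cC clC CV] [cD clD DV]; split.
  + exact: compactU.
  + exact: clopenU.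
  + by rewrite subUset.
- move=> x Kx.
  have [N xN [cN _]] := lcX x I.
  have xNV : nbhs x (N `&` V).
    apply: filterI; first by rewrite withinET in xN.
    by apply: open_nbhs_nbhs; split=> //; exact: KV.
  have [C [BC Cx] CNV] := Bb x _ xNV.
  have [oC cC] := Bclopen _ BC.
  exists C; last exact: open_nbhs_nbhs.
  split=> //; last by move=> y /CNV [].
  by apply: subclosed_compact cN _ => // y /CNV [].
- by exists W.
Qed.

(** A Lebesgue number argument: halving an entourage at [x] gives a neighbourhood with a uniform
    margin inside [C], and a union of two such sets keeps the intersection of their margins. *)
Lemma compact_open_entourage (X : topologicalType) (U : set_system (X * X))
    (C : set X) :
  compatible_uniformity U -> compact C -> open C ->
  exists2 E, U E & forall a b, E (a, b) -> C a -> C b.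
Proof.
move=> cU cC oC; have FU := cunif_filter cU.
pose Q := [set A : set X |
  exists2 E, U E & forall a b, E (a, b) -> A a -> C b].
have [| | |A [E UE EA] CA] := @compact_cover_directed X C Q cC.
- by exists setT => //; exact: filterT.
- move=> A A' [E UE EA] [E' UE' EA'].
  exists (E `&` E') => [|a b [Eab E'ab] [Aa|A'a]]; first exact: filterI.
  + exact: EA Aa.
  + exact: EA' A'a.
- move=> x Cx.
  have : nbhs x C by exact: open_nbhs_nbhs.
  rewrite (cunif_nbhs cU) => -[E UE EC].
  have [D UD DE] := cunif_split cU UE.
  exists (xsection D x); last by exists D.
  exists D => // a b Dab /xsectionP Da.
  by apply/EC/xsectionP/DE; exists a.
- by exists E => // a b Eab /CA; exact: EA.
Qed.

(** The entourage depends on [C] alone, so one neighbourhood of [x] serves all [s]; the inverse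
    entourage gives the converse implication. *)
Lemma equicontinuous_clopen_near (X : topologicalType)
    (U : set_system (X * X)) (S : set (X -> X)) (C : set X) :
  compatible_uniformity U -> equicontinuous_for U S -> compact C -> open C ->
  forall x, \forall y \near x, forall s, S s -> C (s x) <-> C (s y).
Proof.
move=> cU eqS cC oC x.
have [E UE EC] := compact_open_entourage cU cC oC.
have UEE := cunif_inv cU UE.
near=> y => s Ss; split.
  by apply: EC; apply: (near (eqS x _ UE) y).
by apply: EC; apply: (near (eqS x _ UEE) y).
Unshelve. all: by end_near. Qed.

(** * Staying in [W] and leaving it under steps of [S] *)

Section Exit.
Variables (X : topologicalType) (U : set_system (X * X)) (S : set (X -> X)).
Variable W : set X.
Hypotheses (cU : compatible_uniformity U) (eqS : equicontinuous_for U S).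
Hypotheses (symS : S = inverse_maps S) (cW : compact W) (clopenW : clopen W).

Definition stay (C : set X) : set X := C `&` [set x | forall s, S s -> C (s x)].
Definition reach (C : set X) : set X :=
  W `&` [set x | exists2 s, S s & C (s x)].
Definition stay_n (n : nat) : set X := iter n stay W.

Let clopen_in (C : set X) := clopen C /\ C `<=` W.

Let clopen_in_compact (C : set X) : clopen_in C -> compact C.
Proof. by move=> [[_ cC] CW]; exact: subclosed_compact CW. Qed.

(** Possibly infinitely many preimages of [C] are intersected; equicontinuity makes membership in
    the intersection locally constant. *)
Lemma clopen_stay (C : set X) : clopen_in C -> clopen_in (stay C).
Proof.
move=> CC; have [clC CW] := CC; split; last by move=> x [/CW].
apply: clopenI => //; apply: locally_constant_clopen => x.
have := equicontinuous_clopen_near cU eqS (clopen_in_compact CC) clC.1 x.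
by apply: filterS => y xy; split=> Cs s Ss; apply/(xy _ Ss)/Cs.
Qed.

Lemma clopen_reach (C : set X) : clopen_in C -> clopen_in (reach C).
Proof.
move=> CC; have [clC CW] := CC; split; last by move=> x [].
apply: clopenI => //; apply: locally_constant_clopen => x.
have := equicontinuous_clopen_near cU eqS (clopen_in_compact CC) clC.1 x.
by apply: filterS => y xy; split=> -[s Ss Cs]; exists s => //; apply/(xy _ Ss).
Qed.

Lemma clopen_stay_n (n : nat) : clopen_in (stay_n n).
Proof. by elim: n => [|n IH]; [split|exact: clopen_stay]. Qed.

Lemma clopen_iter_reach (n : nat) (C : set X) :
  clopen_in C -> clopen_in (iter n reach C).
Proof. by move=> CC; elim: n => //= n; exact: clopen_reach. Qed.

Lemma iter_reachS (n : nat) (C D : set X) :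
  C `<=` D -> iter n reach C `<=` iter n reach D.
Proof.
move=> CD; elim: n => //= n IH x [Wx [s Ss Cs]].
by split=> //; exists s => //; exact: IH.
Qed.

(** The inverse of the step taken is again in [S], so it leads from [stay C] back into [C]. *)
Lemma reach_stay (C : set X) : reach (stay C) `<=` C.
Proof.
move=> x [_ [s Ss [_ Cs]]].
have [f Sf [fK sK]] : inverse_maps S s by rewrite -symS.
have Sf' : inverse_maps S f by rewrite -symS.
by rewrite -[x]sK; exact: Cs.
Qed.

Lemma iter_reach_orbit (G : set (X -> X)) (n : nat) (C : set X) (x : X) :
  homeo_group G -> S `<=` G -> iter n reach C x ->
  exists2 g, G g & C (g x).
Proof.
move=> grpG SG; elim: n x => [|n IH] x /=.
  by exists id => //; exact: homeo_group_id.
move=> [_ [s Ss /IH [g Gg Cgs]]].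
by exists (g \o s) => //; apply: (homeo_group_comp grpG) => //; exact: SG.
Qed.

(* A point of W_k \ W_(k+1) has a neighbour in W_(k-1) \ W_k; walking down the
   levels from a point of C gives a point of W \ W_1 from which C is reached. *)
Lemma exit_descent (k j : nat) (C : set X) :
  (stay_n k `\` stay_n k.+1) `&` iter j reach C !=set0 ->
  (W `\` stay W) `&` iter (k + j) reach C !=set0.
Proof.
elim: k j => [//|k IH] j [x [[kx nkx] Cx]].
have [s Ss nks] : exists2 s, S s & ~ stay_n k.+1 (s x).
  by apply: contra_notP nkx => nex; split=> // s Ss; apply: contra_notP nex;
     exists s.
have ksx : stay_n k (s x) by case: kx => _; exact.
have [f Sf [_ sK]] : inverse_maps S s by rewrite -symS.
rewrite addSnnS; apply: IH; exists (s x); split=> //=.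
split; first exact: (clopen_stay_n k).2.
by exists f => //; rewrite sK.
Qed.

Lemma exists_exit_point :
  (forall n, ~ (stay_n n `<=` stay_n n.+1)) ->
  exists2 y, ~ stay W y & forall n, iter n reach (stay_n n) y.
Proof.
move=> strict.
pose A n := (W `\` stay W) `&` iter n reach (stay_n n).
have clA n : closed (A n).
  apply: closedI; last exact: (clopen_iter_reach n (clopen_stay_n n)).1.2.
  apply: closedI; first exact: clopenW.2.
  by apply: open_closedC; exact: (clopen_stay_n 1).1.1.
have AW n : A n `<=` W by move=> x [[]].
have Adec n : A n.+1 `<=` A n.
  (* The extra [reach] is moved innermost, where it meets the outer [stay] of [stay_n n.+1]. *)
  move=> x [Wx]; rewrite iterSr => Rx; split=> //.
  by apply: iter_reachS Rx; exact: reach_stay.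
have A0 n : A n !=set0.
  (* The descent starts with no steps taken, at a point of W_n outside W_(n+1). *)
  rewrite /A -[n in iter n]addn0; apply: exit_descent => /=.
  apply: contra_notP (strict n) => nex x nx.
  by apply: contra_notP nex => nSx; exists x.
have [y Ay] := compact_nested_nonempty cW clA AW Adec A0.
by exists y => [|n]; [case: (Ay 0 I) => -[]|case: (Ay n I)].
Qed.

End Exit.

Theorem theorem1p2 (X : topologicalType) (G : set (X -> X)) (V : set X)
    (lcX : locally_compact [set: X]) (zdX : zero_dim_space X)
    (grpG : homeo_group G) (genG : equicontinuously_generated G)
    (oV : open V) (cVoo : compact (invariant_core G V)) :
  open (invariant_core G V) <->
  (forall x, ~ invariant_core G V x ->
     closure (group_orbit G x) `&` invariant_core G V = set0).
Proof.
set K := invariant_core G V.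
split=> [oK x nKx|orbK].
  rewrite -subset0 => z [clz Kz].
  have [|_ [[g Gg <-] Kgx]] := clz K; first exact: open_nbhs_nbhs.
  apply: nKx.
  have [_ [g' _ [gK g'K]]] := homeo_group_homeo grpG Gg.
  have Gg' : G g' by apply: (homeo_group_inv grpG); exists g.
  by rewrite -[x]gK; exact: invariant_core_stable.
have [S [genS symS [U cU eqS]]] := genG.
have SG : S `<=` G by rewrite genS; exact: sub_gen_smallest.
have [W [cW clW KW WV]] :=
  compact_clopen_between lcX zdX cVoo oV (invariant_core_sub grpG (V := V)).
pose Wn := stay_n S W.
have Wncl n := clopen_stay_n cU eqS cW clW n.
have WnV n : Wn n `<=` V by move=> x /(Wncl n).2 /WV.
have KWn n : K `<=` Wn n.
  elim: n => // n IH x Kx; split; first exact: IH.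
  by move=> s Ss; apply/IH/invariant_core_stable => //; exact: SG.
(* If the levels stabilise at [n], then [Wn n] is stable under [S] and so equals [K]. *)
have [[n nS]|strict] := pselect (exists n, Wn n `<=` Wn n.+1).
  suff -> : K = Wn n by exact: (Wncl n).1.1.
  apply/seteqP; split; first exact: KWn.
  apply: (stable_sub_invariant_core grpG genS symS) => // s x Ss /nS [_].
  exact.
have [|y nWy reachy] := exists_exit_point cU eqS symS cW clW.
  by move=> n nS; apply: strict; exists n.
have nKy : ~ K y by move=> /(KWn 1).
have capWn : \bigcap_n Wn n `<=` K.
  apply: (stable_sub_invariant_core grpG genS symS).
    by move=> x /(_ 0 I) /(WnV 0).
  by move=> s x Ss Wx n _; have [_] := Wx n.+1 I; exact.
(* The orbit of [y] meets every [Wn n], so a common point [z] lies in its closure and in [K],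
   against [orbK] at [y]. *)
have [| | | |z zP] := @compact_nested_nonempty _ W
    (fun n => closure (group_orbit G y) `&` Wn n) cW.
- by move=> n; apply: closedI; [exact: closed_closure|exact: (Wncl n).1.2].
- by move=> n x [_ /(Wncl n).2].
- by move=> n x [clx []].
- move=> n; have [g Gg Wg] := iter_reach_orbit grpG SG (reachy n).
  by exists (g y); split=> //; apply: subset_closure; exists g.
have : (closure (group_orbit G y) `&` K) z.
  by split; [have [] := zP 0 I|apply: capWn => n In; have [] := zP n In].
by rewrite orbK.
Qed.
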